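(* Let $n\ge 2$. There is a bijection $\Phi$ from the set of $n\times n$ permutation matrices to the set of TSSCPP boolean triangles of order $n$ with weakly decreasing rows such that for every permutation matrix $P$, writing $b=\Phi(P)$: (i) the number of entries of $b$ equal to $0$ equals the inversion number of $P$; (ii) if the $1$ in the last row of $P$ lies in column $k$, then exactly $n-k$ of the zeros of $b$ lie in its last row (row $n-1$); (iii) if the $1$ in the last column of $P$ lies in row $\ell$, then the lowest $1$ in diagonal $n-1$ of $b$ (i.e. among the entries $b_{1,n-1},b_{2,n-1},\dots,b_{n-1,n-1}$) is in row $\ell-1$, that is, $b_{i,n-1}=0$ for all $\ell\le i\le n-1$ and, if $\ell\geq 2$, $b_{\ell-1,n-1}=1$.
   Context: A TSSCPP boolean triangle of order $n$ is an array $\{b_{i,j}\}$ indexed by $1\leq i\leq n-1$, $n-i\leq j\leq n-1$ (row $i$ has the $i$ entries $b_{i,n-i},\dots,b_{i,n-1}$), with entries in $\{0,1\}$, such that for all $j$ and all $i'$ with $j\le i'\le n-1$ the diagonal partial sums satisfy $$1+\sum_{i=j+1}^{i'} b_{i,n-j-1} \;\geq\; \sum_{i=j}^{i'} b_{i,n-j},$$ where sums over empty index ranges are $0$. Its rows are weakly decreasing if $b_{i,j}\ge b_{i,j+1}$ whenever both entries exist. An $n\times n$ permutation matrix $P$ corresponds to the permutation $\sigma$ with $P_{i,\sigma(i)}=1$; its inversion number is the number of pairs $i<j$ with $\sigma(j)<\sigma(i)$. In (iii), the case $\ell=1$ means that diagonal $n-1$ contains no $1$. *)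

(* Defs.v *)
From HB Require Import structures.
From mathcomp Require Import all_boot all_order fingroup perm all_algebra.

Set Implicit Arguments.
Unset Strict Implicit.
Unset Printing Implicit Defensive.

(* (i, j) with n - i <= j <= n - 1, for row i and column (or diagonal)
   j; this forces 1 <= i, since row 0 has no admissible j < n. *)
Definition tri_pos (n : nat) := {p : 'I_n * 'I_n | n - p.1 <= p.2}.

Definition tri_row (n : nat) (p : tri_pos n) : nat := (val p).1.
Definition tri_col (n : nat) (p : tri_pos n) : nat := (val p).2.

Definition bool_array (n : nat) := {ffun tri_pos n -> bool}.

(* b_{i,j}, read as 0 when (i, j) is not a position of the array. *)
Definition entry (n : nat) (b : bool_array n) (i j : nat) : bool :=
  [exists p : tri_pos n, [&& tri_row p == i, tri_col p == j & b p]].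

Lemma entryE (n : nat) (b : bool_array n) (p : tri_pos n) :
  entry b (tri_row p) (tri_col p) = b p.
Proof.
apply/existsP/idP => [[q /and3P[/eqP rq /eqP cq bq]]|bp]; last first.
  by exists p; rewrite !eqxx.
suff -> : p = q by [].
apply/val_inj; case: p q rq cq {bq} => [[i j] pij] [[k l] pkl].
by rewrite /tri_row /tri_col /= => /val_inj-> /val_inj->.
Qed.

(* For j = n - 1 the left-hand sum is empty; diagonal 0 does not exist. *)
Definition is_tsscpp (n : nat) (b : bool_array n) : bool :=
  [forall j : 'I_n, forall i' : 'I_n, (1 <= j <= i') ==>
    (\sum_(j <= i < i'.+1) entry b i (n - j)
       <= 1 + \sum_(j.+1 <= i < i'.+1) entry b i (n - j - 1))].

Definition rows_decreasing (n : nat) (b : bool_array n) : bool :=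
  [forall p : tri_pos n, forall q : tri_pos n,
    (tri_row p == tri_row q) && (tri_col q == (tri_col p).+1) ==> (b q <= b p)].

Definition decreasing_tsscpp (n : nat) :=
  {b : bool_array n | is_tsscpp b && rows_decreasing b}.

(* perm_mx s has its 1 of row i in column s i. *)
Definition permutation_matrix (n : nat) := {P : 'M[int]_n | is_perm_mx P}.

Definition inversion_number (n : nat) (s : 'S_n) : nat :=
  #|[set p : 'I_n * 'I_n | (p.1 < p.2) && (s p.2 < s p.1)]|.

Definition num_zeros (n : nat) (b : bool_array n) : nat :=
  #|[set p : tri_pos n | ~~ b p]|.

Definition num_zeros_row (n : nat) (b : bool_array n) (i : nat) : nat :=
  #|[set p : tri_pos n | (tri_row p == i) && ~~ b p]|.

(* Main.v *)
Require Import Defs.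
From HB Require Import structures.
From mathcomp Require Import all_boot all_order fingroup perm all_algebra.
From mathcomp Require Import zify.

(** A weakly decreasing row [i] is determined by its number [z_i <= i] of
    zeros, and weak decrease alone forces the diagonal inequalities, so the
    triangles are exactly the sequences [(z_i)] with [0 <= z_i <= i].  The
    bijection sends [s] to its Lehmer code
    [z_i = #{j < i | s j > s i}]: the code of [s] sums to the inversion number,
    its last term counts the values above the last value of [s], and the last
    vanishing term is at the position of the maximum of [s]. *)

Set Implicit Arguments.
Unset Strict Implicit.
Unset Printing Implicit Defensive.

Lemma card_ord_geq n c : #|[set j : 'I_n | c <= j]| = n - c.
Proof.
rewrite -sum1dep_card big_mkcond /=.
elim: n => [|n IHn]; first by rewrite big_ord0.
by rewrite big_ord_recr /= IHn; case: leqP => ?; lia.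
Qed.

(** * Rows of a triangle and their zeros *)

Section Triangle.
Variable n : nat.
Implicit Types (b : bool_array n) (p q : tri_pos n).

Lemma tri_pos_exists i j : i < n -> j < n -> n - i <= j ->
  exists p, tri_row p = i /\ tri_col p = j.
Proof.
move=> i_n j_n ij.
by exists (exist _ (Ordinal i_n, Ordinal j_n) ij : tri_pos n).
Qed.

Lemma tri_pos_inj p q : tri_row p = tri_row q -> tri_col p = tri_col q -> p = q.
Proof.
case: p q => [[i j] pij] [[k l] pkl]; rewrite /tri_row /tri_col /= => eik ejl.
by apply/val_inj; congr (_, _); apply/val_inj.
Qed.

Lemma card_row_geq i c : i < n -> n - i <= c ->
  #|[set p : tri_pos n | (tri_row p == i) && (c <= tri_col p)]| = n - c.
Proof.
move=> i_n ic; rewrite -card_ord_geq.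
set A := [set p | _].
have inj : {in A &, injective (fun p : tri_pos n => (val p).2)}.
  move=> p q; rewrite !inE => /andP[/eqP rp _] /andP[/eqP rq _] epq.
  by apply: tri_pos_inj; rewrite ?rp ?rq // /tri_col epq.
rewrite -(card_in_imset inj); congr #|pred_of_set _|.
apply/setP => j; rewrite inE; apply/imsetP/idP => [[p]|cj].
  by rewrite inE => /andP[_ cp] ->.
have [p [rp cp]] := tri_pos_exists i_n (ltn_ord j) (leq_trans ic cj).
by exists p; [rewrite inE rp cp eqxx | apply/val_inj].
Qed.

Lemma entry_decr b i j d : rows_decreasing b -> i < n -> n - i <= j ->
  entry b i (j + d) -> entry b i j.
Proof.
move=> decr i_n ij; elim: d => [|d IHd]; first by rewrite addn0.
rewrite addnS => /existsP[q /and3P[/eqP rq /eqP cq bq]]; apply: IHd.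
have jn : j + d < n by rewrite ltnW // -cq; apply: ltn_ord.
have [|p [rp cp]] := tri_pos_exists i_n jn; first by lia.
rewrite -rp -cp entryE.
have /forallP/(_ p)/forallP/(_ q)/implyP := decr.
by rewrite rp rq cp cq !eqxx bq lt0b; apply.
Qed.

(** The term [i = j] of the longer sum is at most 1; every other term is bounded by its left
    neighbour in the same row, which is a term of the other sum. *)
Lemma decr_tsscpp b : rows_decreasing b -> is_tsscpp b.
Proof.
move=> decr; apply/forallP => j; apply/forallP => i'; apply/implyP => /andP[j0 ji].
rewrite big_ltn ?ltnS //; apply: leq_add; first exact: leq_b1.
rewrite big_nat_cond [leqRHS]big_nat_cond; apply: leq_sum => i.
rewrite andbT => /andP[jlti ii'].
have i_n : i < n by have := ltn_ord i'; lia.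
case: (boolP (entry b i (n - j))) => // e; rewrite lt0b.
(* Column [n - j - 1] still belongs to row [i] because [j < i]. *)
apply: (@entry_decr _ _ _ 1) => //; first by lia.
by have -> : n - j - 1 + 1 = n - j by lia.
Qed.

(** In a weakly decreasing row the zeros come last, and the last column is [n - 1]; so [z] zeros
    fill exactly the columns from [n - z] on. *)
Lemma decr_entryE b p : rows_decreasing b ->
  b p = (tri_col p + num_zeros_row b (tri_row p) < n).
Proof.
move=> decr.
have [i_n c_n] := (ltn_ord (val p).1, ltn_ord (val p).2).
rewrite -/(tri_row p) -/(tri_col p) in i_n c_n.
have rc : n - tri_row p <= tri_col p := valP p.
have mono q q' : tri_row q = tri_row q' -> tri_col q <= tri_col q' -> b q' -> b q.
  move=> r c; rewrite -!entryE -r -(subnKC c); apply: entry_decr => //.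
    exact: ltn_ord.
  exact: (valP q).
apply/idP/idP => [bp|].
  (* All zeros of the row lie strictly to the right of a 1 at [p]. *)
  suff : num_zeros_row b (tri_row p) <= n - (tri_col p).+1 by lia.
  rewrite -(@card_row_geq (tri_row p)) //; last by lia.
  apply/subset_leq_card/subsetP => q; rewrite !inE => /andP[/eqP rq].
  rewrite rq eqxx /=; apply: contraNT; rewrite -leqNgt => cq.
  exact: mono bp.
(* A 0 at [p] forces zeros at all [n - tri_col p] positions from [p] on. *)
apply: contraTT => bp; rewrite -leqNgt -leq_subLR -(card_row_geq i_n rc).
apply/subset_leq_card/subsetP => q; rewrite !inE => /andP[/eqP rq cq].
by rewrite rq eqxx /=; apply: contraNN bp; exact: mono.
Qed.

Lemma num_zeros_row_le b i : i < n -> num_zeros_row b i <= i.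
Proof.
move=> i_n.
have {2}<- : n - (n - i) = i by lia.
rewrite -(card_row_geq i_n (leqnn _)); apply/subset_leq_card/subsetP => p.
rewrite !inE => /andP[/eqP <- _]; rewrite eqxx; exact: (valP p).
Qed.

Lemma num_zeros_rows b : num_zeros b = \sum_(i < n) num_zeros_row b i.
Proof.
rewrite /num_zeros -sum1dep_card (partition_big (fun p => (val p).1) predT) //=.
apply: eq_bigr => i _; rewrite sum1dep_card; apply: eq_card => p.
by rewrite !inE andbC.
Qed.

(** The dependent codomain has exactly [n]! elements; [inord] never takes its default value, by
    [num_zeros_row_le]. *)
Definition row_zeros (b : decreasing_tsscpp n) : {dffun forall i : 'I_n, 'I_i.+1} :=
  [ffun i : 'I_n => inord (num_zeros_row (val b) i) : 'I_i.+1].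

Lemma row_zeros_inj : injective row_zeros.
Proof.
move=> b1 b2 /ffunP e.
have d (b : decreasing_tsscpp n) : rows_decreasing (val b) by case/andP: (valP b).
apply/val_inj/ffunP => p; rewrite (decr_entryE p (d b1)) (decr_entryE p (d b2)).
have := congr1 val (e (val p).1).
by rewrite !ffunE /= !inordK ?ltnS ?num_zeros_row_le // => ->.
Qed.

Lemma card_decreasing_tsscpp : #|{: decreasing_tsscpp n}| <= n`!.
Proof.
apply: (leq_trans (leq_card _ row_zeros_inj)).
rewrite card_dep_ffun foldrE big_map big_enum /= fact_prod big_add1 big_mkord.
by under eq_bigr => i _ do rewrite card_ord.
Qed.

(** * The Lehmer code of a permutation *)

Section LehmerCode.
Implicit Types s t : 'S_n.

Definition lehmer s (i : 'I_n) := #|[set j : 'I_n | (j < i) && (s i < s j)]|.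

Lemma lehmer_le s i : lehmer s i <= i.
Proof.
have -> : nat_of_ord i = #|~: [set j : 'I_n | i <= j]|.
  rewrite cardsCs setCK card_ord card_ord_geq subKn //; exact/ltnW.
by apply/subset_leq_card/subsetP => j; rewrite !inE -ltnNge => /andP[].
Qed.

(** Inversions are grouped by their later position. *)
Lemma inversion_number_lehmer s : inversion_number s = \sum_(i < n) lehmer s i.
Proof.
rewrite /inversion_number -sum1dep_card (partition_big snd predT) //=.
apply: eq_bigr => i _; rewrite sum1dep_card /lehmer.
have inj : injective (fun j : 'I_n => (j, i)) by move=> j k [].
rewrite -(card_imset _ inj).
apply: eq_card => -[j k]; rewrite !inE /=; apply/idP/imsetP.
  by case/andP => lt /eqP <-; exists j; rewrite ?inE.
by case=> j'; rewrite inE => lt [-> ->]; rewrite lt eqxx.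
Qed.

(** Counting values [x = s j] instead of positions makes the first condition depend only on which
    values [s] takes beyond [i]. The case [j = i] is harmless, as [s i < x] excludes it. *)
Lemma lehmer_values s i :
  lehmer s i = #|[set x : 'I_n | (s^-1%g x <= i) && (s i < x)]|.
Proof.
rewrite /lehmer -(card_imset _ (@perm_inj _ s)); apply: eq_card => x.
rewrite !inE -{1}[x](permKV s) mem_imset ?inE ?permKV; last exact: perm_inj.
rewrite [in RHS]leq_eqVlt; case: (eqVneq (s^-1%g x) i) => [<-|ne].
  by rewrite permKV !ltnn !andbF.
by rewrite (negPf (ne : _ != _ :> nat)).
Qed.

(* By descending induction on [i]: [s] and [t] agree beyond [i], so [s i] and
   [t i] lie in the same set of remaining values, where they have the same
   rank. *)
Lemma lehmer_inj s t : lehmer s =1 lehmer t -> s = t.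
Proof.
move=> e; apply/permP.
suff H d : forall i : 'I_n, n <= i + d -> s i = t i.
  by move=> i; apply: (H n); rewrite leq_addl.
elim: d => [|d IHd] i; first by have := ltn_ord i; lia.
rewrite addnS => le_n.
have agree (j : 'I_n) : i < j -> s j = t j by move=> ij; apply: IHd; lia.
have rest x : (s^-1%g x <= i) = (t^-1%g x <= i).
  rewrite [LHS]leqNgt [RHS]leqNgt; congr (~~ _).
  apply/idP/idP => lt.
    by rewrite -[x](permKV s) agree // permK.
  by rewrite -[x](permKV t) -agree // permK.
(* If [u i < v i], then [u] counts every value that [v] counts, and [v i] as well. *)
have neq (u v : 'S_n) : (forall x, (u^-1%g x <= i) = (v^-1%g x <= i)) ->
    lehmer u i = lehmer v i -> ~~ (u i < v i).
  move=> uv; rewrite !lehmer_values => euv; apply/negP => lt.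
  suff /proper_card : [set x : 'I_n | (v^-1%g x <= i) && (v i < x)]
     \proper [set x : 'I_n | (u^-1%g x <= i) && (u i < x)] by rewrite euv ltnn.
  apply/properP; split.
    by apply/subsetP => x; rewrite !inE uv => /andP[-> /(ltn_trans lt)].
  by exists (v i); rewrite !inE ?uv permK leqnn ?ltnn.
apply/val_inj/eqP; rewrite eqn_leq leqNgt (neq t s) //=.
by rewrite leqNgt (neq s t).
Qed.

Lemma lehmer_last s (i : 'I_n) : i.+1 = n -> lehmer s i = n - (s i).+1.
Proof.
move=> i_n; rewrite lehmer_values -card_ord_geq; apply: eq_card => x.
by rewrite !inE -ltnS i_n ltn_ord.
Qed.

Lemma lehmer_max s (m l : 'I_n) : m.+1 = n -> s l = m -> lehmer s l = 0.
Proof.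
move=> m_n sl; apply: eq_card0 => j; rewrite !inE sl andbC.
by have := ltn_ord (s j); case: ltnP => //; lia.
Qed.

(** The position [l] of the maximum is itself counted at every later [i]. *)
Lemma lehmer_after_max s (m l i : 'I_n) :
  m.+1 = n -> s l = m -> l < i -> 0 < lehmer s i.
Proof.
move=> m_n sl li; apply/card_gt0P; exists l; rewrite inE li sl /=.
rewrite ltn_neqAle -ltnS m_n ltn_ord andbT -sl (inj_eq val_inj) (inj_eq perm_inj).
by apply: contraTneq li => ->; rewrite ltnn.
Qed.

(** * The triangle of a Lehmer code *)

Definition lehmer_triangle s : bool_array n :=
  [ffun p => tri_col p + lehmer s (val p).1 < n].

Lemma lehmer_triangle_decr s :
  is_tsscpp (lehmer_triangle s) && rows_decreasing (lehmer_triangle s).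
Proof.
suff decr : rows_decreasing (lehmer_triangle s) by rewrite decr_tsscpp.
apply/forallP => p; apply/forallP => q; apply/implyP => /andP[/eqP r /eqP c].
rewrite !ffunE c addSn (val_inj r : (val p).1 = (val q).1).
by case: ltnP => // lt; rewrite lt0b ltnW.
Qed.

Lemma lehmer_triangle_zeros s (i : 'I_n) :
  num_zeros_row (lehmer_triangle s) i = lehmer s i.
Proof.
have [le_i i_n] := (lehmer_le s i, ltn_ord i).
(* The zeros are the columns from [n - lehmer s i] on, all inside row [i] by [lehmer_le]. *)
have <- : n - (n - lehmer s i) = lehmer s i by lia.
rewrite -(@card_row_geq i) //; last by lia.
apply: eq_card => p; rewrite !inE ffunE -leqNgt.
case: eqP => //= /val_inj ->; lia.
Qed.

Definition lehmer_tsscpp s : decreasing_tsscpp n :=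
  exist _ (lehmer_triangle s) (lehmer_triangle_decr s).

(** An injection from [n]! permutations into at most [n]! triangles is bijective, so no inverse is
    constructed. *)
Lemma lehmer_tsscpp_bij : bijective lehmer_tsscpp.
Proof.
apply: inj_card_bij; last first.
  by rewrite card_Sn card_decreasing_tsscpp.
move=> s t /(congr1 val)/= e; apply: lehmer_inj => i.
by rewrite -!lehmer_triangle_zeros e.
Qed.

(** The last entry of a row is 1 exactly when the row has no zero. Row 0 is empty, so there [entry]
    is false although the code vanishes. *)
Lemma lehmer_triangle_entry s (i : 'I_n) : 0 < i ->
  entry (lehmer_triangle s) i (n - 1) = (lehmer s i == 0).
Proof.
move=> i0; have i_n := ltn_ord i.
have [|||p [rp cp]] := @tri_pos_exists i (n - 1) => //; try by lia.
rewrite -{1}rp -cp entryE ffunE cp (val_inj rp : (val p).1 = i); lia.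
Qed.

End LehmerCode.
End Triangle.

(** * Permutation matrices as permutations *)

Section PermutationMatrix.
Variable n : nat.

Lemma is_perm_mx_exists (P : permutation_matrix n) :
  exists s : 'S_n, val P == perm_mx s.
Proof. exact/existsP/(valP P). Qed.

Definition perm_of_mx (P : permutation_matrix n) : 'S_n :=
  xchoose (is_perm_mx_exists P).

Lemma perm_of_mxE (P : permutation_matrix n) : val P = perm_mx (perm_of_mx P).
Proof. exact/eqP/(xchooseP (is_perm_mx_exists P)). Qed.

Lemma perm_of_mx_eq1 (P : permutation_matrix n) i j : val P i j = 1%R -> perm_of_mx P i = j.
Proof. by rewrite perm_of_mxE !mxE; case: eqP. Qed.

Lemma perm_of_mx_bij : bijective perm_of_mx.
Proof.
exists (fun s => exist _ (perm_mx s) (perm_mx_is_perm _ s)) => [P|s].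
  by apply/val_inj; rewrite /= perm_of_mxE.
by apply/permP => i; apply: perm_of_mx_eq1; rewrite !mxE eqxx.
Qed.

End PermutationMatrix.

(* Row and column indices of matrices are elements of 'I_n, hence 0-based:
   the 1-based column k and row l of the informal text are k.+1 and l.+1. *)
Theorem theorem3p5 (n : nat) (hn : 2 <= n) :
  exists Phi : permutation_matrix n -> decreasing_tsscpp n,
    bijective Phi /\
    forall P : permutation_matrix n,
      let M : 'M[int]_n := val P in
      let b : bool_array n := val (Phi P) in
      [/\ forall s : 'S_n, (forall i : 'I_n, M i (s i) = 1%R) ->
            num_zeros b = inversion_number s,
          forall last k : 'I_n, last.+1 = n -> M last k = 1%R ->
            num_zeros_row b (n - 1) = n - k.+1
        & forall last l : 'I_n, last.+1 = n -> M l last = 1%R ->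
            (forall i : nat, l.+1 <= i <= n - 1 ->
               entry b i (n - 1) = false) /\
            (2 <= l.+1 -> entry b (l.+1 - 1) (n - 1) = true)].
Proof.
exists (@lehmer_tsscpp n \o @perm_of_mx n); split.
  exact: bij_comp (@lehmer_tsscpp_bij n) (@perm_of_mx_bij n).
move=> P M b; split.
- move=> s Ms.
  have -> : s = perm_of_mx P by apply/permP => i; rewrite (perm_of_mx_eq1 (Ms i)).
  rewrite num_zeros_rows inversion_number_lehmer; apply: eq_bigr => i _.
  exact: lehmer_triangle_zeros.
- move=> last k last_n /perm_of_mx_eq1 <-.
  have -> : n - 1 = last by lia.
  by rewrite lehmer_triangle_zeros lehmer_last.
move=> last l last_n /perm_of_mx_eq1 Pl; split=> [i /andP[li i_n]|l0].
  have lt_i : i < n by lia.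
  rewrite (@lehmer_triangle_entry _ _ (Ordinal lt_i)) /=; last by lia.
  by rewrite eqn0Ngt (lehmer_after_max last_n Pl).
(* Row [i] of the triangle carries the code at the 0-based position [i], so row [l.+1 - 1] belongs
   to the position [l] of the maximum. *)
rewrite subSS subn0 lehmer_triangle_entry //.
by rewrite (lehmer_max last_n Pl).
Qed.
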